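(* Let $n\ge3$, let $q\ge2$ be an integer, and let $C>0$. There is a smooth rotationally symmetric metric on $\mathbb S^n$ that is positively curved (all sectional curvatures positive) away from two poles, flat at the poles (the Riemann curvature tensor vanishes there), and exactly $1/q$-pinched at every nonflat point.
   Context: At a point $p$ where the Riemann curvature tensor is nonzero and all sectional curvatures have one strict sign, put $\delta_{\mathrm{sec}}(p)=\min_\sigma|K_p(\sigma)|/\max_\sigma|K_p(\sigma)|$, the extrema being over $2$-planes $\sigma\subset T_pM$. ''Exactly $1/q$-pinched at $p$'' means $\delta_{\mathrm{sec}}(p)=1/q$. Rotationally symmetric means of the form $dt^2+f(t)^2g_{\mathbb S^{n-1}}$ away from the two poles. The constant $C$ is a free scale parameter. *)

(* Defs.v *)
From HB Require Import structures.
From mathcomp Require Import all_boot all_order all_algebra.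
From mathcomp Require Import all_classical all_reals all_analysis.

Set Implicit Arguments.
Unset Strict Implicit.
Unset Printing Implicit Defensive.

Import Order.TTheory GRing.Theory Num.Theory.
Import numFieldNormedType.Exports.

Local Open Scope classical_set_scope.
Local Open Scope ring_scope.

(* Directional derivatives along all constant vectors are used in place of
   partial derivatives; [V] is meant to be finite-dimensional and [U] open. *)
Fixpoint Ck_on (R : realType) (V W : normedModType R) (U : set V) (k : nat)
    (h : V -> W) : Prop :=
  (forall x, U x -> {for x, continuous h}) /\
  (if k is k'.+1 then
     forall v : V,
       (forall x, U x -> derivable h x v) /\ Ck_on U k' (fun x => 'D_v h x)
   else True).

Definition smooth_on (R : realType) (V W : normedModType R) (U : set V)
    (h : V -> W) : Prop := forall k, Ck_on U k h.

Section Coordinates.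
Variables (R : realType) (n : nat).
Implicit Types (G : 'rV[R]_n -> 'M[R]_n) (x u v : 'rV[R]_n) (i j k l : 'I_n).

Definition bilin (M : 'M[R]_n) u v : R := (u *m M *m v^T) 0 0.

Definition partial i (h : 'rV[R]_n -> R) x : R := 'D_(delta_mx 0 i) h x.

(* [christoffel G k i j] is Gamma^k_{ij} *)
Definition christoffel G k i j x : R :=
  2^-1 * \sum_l invmx (G x) k l *
    (partial i (fun y => G y j l) x + partial j (fun y => G y i l) x
     - partial l (fun y => G y i j) x).

(* the d_l component of R(d_i, d_j) d_k, where
   R(X, Y) Z = nabla_X nabla_Y Z - nabla_Y nabla_X Z - nabla_[X, Y] Z *)
Definition riemann_op G l i j k x : R :=
  partial i (christoffel G l j k) x - partial j (christoffel G l i k) x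
  + \sum_m (christoffel G l i m x * christoffel G m j k x
            - christoffel G l j m x * christoffel G m i k x).

(* < R(d_i, d_j) d_k, d_l > *)
Definition riemann G i j k l x : R :=
  \sum_m riemann_op G m i j k x * G x m l.

(* the sectional curvature < R(u, v) v, u > / |u /\ v|^2 of the plane spanned
   by [u] and [v] *)
Definition sectional G x u v : R :=
  (\sum_i \sum_j \sum_k \sum_l
     riemann G i j k l x * u 0 i * v 0 j * v 0 k * u 0 l)
  / (bilin (G x) u u * bilin (G x) v v - bilin (G x) u v ^+ 2).

End Coordinates.

Section Sphere.
Variables (R : realType) (n : nat).

(* The matrix norm of the library is the sup norm, hence [dotp]. *)
Definition dotp (m : nat) (u v : 'rV[R]_m) : R := (u *m v^T) 0 0.

(* S^n is the unit sphere of R^n x R; the last coordinate is the height. *)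
Definition sphere : set 'rV[R]_(n + 1) := [set p | dotp p p = 1].

Definition tangent (p : 'rV[R]_(n + 1)) : set 'rV[R]_(n + 1) :=
  [set u | dotp p u = 0].

Definition pole (s : bool) : 'rV[R]_(n + 1) := row_mx 0 ((-1) ^+ s)%:M.

Definition is_pole (p : 'rV[R]_(n + 1)) : Prop := exists s, p = pole s.

(* The inverse of the stereographic projection from [pole s]: a global
   parametrization of the complement of [pole s] in the sphere.  The two of
   them define the smooth structure of S^n. *)
Definition stereo (s : bool) (x : 'rV[R]_n) : 'rV[R]_(n + 1) :=
  (dotp x x + 1)^-1 *:
    row_mx (2 *: x) ((-1) ^+ s * (dotp x x - 1))%:M.

(* [g p u v] is the inner product of u, v in T_p S^n; the values of [g] off the
   sphere or on non-tangent vectors are irrelevant. *)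
Definition tensor2 : Type :=
  'rV[R]_(n + 1) -> 'rV[R]_(n + 1) -> 'rV[R]_(n + 1) -> R.

Implicit Types (g : tensor2) (p : 'rV[R]_(n + 1)).

Definition in_chart g (s : bool) (x : 'rV[R]_n) : 'M[R]_n :=
  \matrix_(i, j) g (stereo s x) ('D_(delta_mx 0 i) (stereo s) x)
                                ('D_(delta_mx 0 j) (stereo s) x).

Definition smooth_metric g : Prop :=
  [/\ forall p, sphere p -> forall (a : R) u u' v,
        tangent p u -> tangent p u' -> tangent p v ->
        g p (a *: u + u') v = a * g p u v + g p u' v,
      forall p, sphere p -> forall u v,
        tangent p u -> tangent p v -> g p u v = g p v u,
      forall p, sphere p -> forall u, tangent p u -> u != 0 -> 0 < g p u u
    & forall s i j,
        smooth_on setT (fun x : 'rV[R]_n => in_chart g s x i j : R)].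

(* Curvature at a point is read in every stereographic chart around it. *)
Definition flat_at g p : Prop :=
  forall s x, stereo s x = p ->
    forall i j k l, riemann (in_chart g s) i j k l x = 0.

Definition sec_curvatures g p : set R :=
  [set K | exists s x, stereo s x = p /\
     exists u v : 'rV[R]_n,
       row_free (col_mx u v) /\ K = sectional (in_chart g s) x u v].

(* [d] is delta_sec(p), including the conditions under which the latter is
   defined *)
Definition pinched_exactly g p (d : R) : Prop :=
  [/\ ~ flat_at g p,
      (forall K, sec_curvatures g p K -> 0 < K) \/
      (forall K, sec_curvatures g p K -> K < 0)
    & exists m M : R,
        let absK := [set `|K| | K in sec_curvatures g p] in
        [/\ absK m /\ lbound absK m, absK M /\ ubound absK M & d = m / M]].

(* For [phi] a diffeomorphism from ]0, L[ to ]0, pi[, the map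
   (t, theta) |-> polar phi t theta is a diffeomorphism from
   ]0, L[ x S^{n-1} to the sphere minus its poles, sending ]0, L[ x {theta} to
   the open meridian through theta. *)
Definition polar (phi : R -> R) (t : R) (theta : 'rV[R]_n) :
    'rV[R]_(n + 1) :=
  row_mx (sin (phi t) *: theta) (cos (phi t))%:M.

(* The pullback of [g] by [polar phi] is dt^2 + f(t)^2 g_{S^{n-1}}. *)
Definition rotationally_symmetric g : Prop :=
  exists (L : R) (phi f : R -> R),
    [/\ 0 < L,
        [/\ smooth_on `]0, L[ (phi : R^o -> R^o),
            set_bij `]0, L[ `]0, pi[ phi
          & forall t, t \in `]0, L[ -> 0 < derive1 phi t],
        smooth_on `]0, L[ (f : R^o -> R^o),
        forall t, t \in `]0, L[ -> 0 < f t
      & forall t, t \in `]0, L[ ->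
        forall theta : 'rV[R]_n, dotp theta theta = 1 ->
        forall (a b : R) (v w : 'rV[R]_n),
          dotp theta v = 0 -> dotp theta w = 0 ->
          g (polar phi t theta)
            (a *: derive1 (fun t' : R => polar phi t' theta) t
             + 'D_v (polar phi t) theta)
            (b *: derive1 (fun t' : R => polar phi t' theta) t
             + 'D_w (polar phi t) theta)
          = a * b + f t ^+ 2 * dotp v w].

End Sphere.

Arguments sphere {R n}.

(* Main.v *)
(* A warped metric [dt^2 + f^2 g_{S^{n-1}}] has radial curvature [- f'' / f]
   and tangential curvature [(1 - f'^2) / f^2], so their ratio is [q] as soon
   as [f'^2 = 1 - f^(2 q)].  With [f = sin phi] this reads
   [phi'^2 = P (sin^2 phi)] where [P s = 1 + s + ... + s^(q - 1)], so that
   [dt^2 = d phi^2 / P (sin^2 phi)].  Writing [z = cos phi] for the height,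
   [s = 1 - z^2] and [P = 1 + s Q], the metric is [g_round - (Q / P) dz^2],
   which is rational on the sphere, hence smooth at the poles, and its
   sectional curvatures range from [s^(q - 1)] to [q s^(q - 1)].  In both
   stereographic charts it has the form
   [A (|x|^2) delta_ij + B (|x|^2) x_i x_j].  Below, [q = r + 2]. *)
Require Import Defs.
From mathcomp Require Import all_boot all_order all_algebra.
From mathcomp Require Import all_classical all_reals all_analysis.
From mathcomp Require Import ring lra.

Set Implicit Arguments.
Unset Strict Implicit.
Unset Printing Implicit Defensive.

Import Order.TTheory GRing.Theory Num.Theory.
Import numFieldNormedType.Exports.

Local Open Scope classical_set_scope.
Local Open Scope ring_scope.

(** * Derivatives and smooth functions *)

(** Differentiating [f'^2 = 1 - f^(2 q)] gives [f'' = - q f^(2 q - 1)], so the two curvatures are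
    [q f^(2 q - 2)] and [f^(2 q - 2)]. The profile [f] solves an ODE whose inverse is an elliptic
    integral already for [q = 2], and reading smoothness at the poles off [f] would require its
    expansion there. The change of variable [f = sin phi] removes this obstacle: as [q] is an
    integer, [1 - s] divides [1 - s^q], and the quotient [P] is a polynomial that is at least 1 for
    [s >= 0]. Thus no denominator vanishes, and the arc length [t] is needed only for rotational
    symmetry, away from the poles. The curvature is computed from Christoffel symbols in the charts,
    which treats poles and other points alike; these symbols are guessed up to three radial
    coefficients and then verified. *)

Section Derivatives.
Variable R : realType.
Implicit Types (V : normedModType R).

(** Only derivability along [v] is assumed, so the one-variable chain rule is applied to the
    restriction of [f] to the line through [x] in direction [v]. *)
Lemma is_derive_comp V (f : V -> R) (s : R -> R) x v (df ds : R) :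
  is_derive x v f df -> is_derive (f x) 1 s ds ->
  is_derive x v (fun y => s (f y)) (df * ds).
Proof.
move=> Df Ds.
pose l (F : V -> R) := fun h : R => F (h *: v + x).
have lE (F : V -> R) : (fun h : R => h^-1 *: ((F \o shift x) (h *: v) - F x))
   = (fun h : R => h^-1 *: ((l F \o shift 0) (h *: 1) - l F 0)).
  by apply/funext => h /=; rewrite /l /= !addr0 scale0r add0r [h *: 1]mulr1.
have lP (F : V -> R) dF : is_derive x v F dF <-> is_derive (0 : R) 1 (l F) dF.
  by split=> -[d e]; constructor;
    move: d e; rewrite /derivable /derive lE.
apply/lP.
have /lP Dl := Df.
have := @is_derive1_comp R s (l f) 0 ds df.
rewrite mulrC; apply => //.
by rewrite /l scale0r add0r.
Qed.

Lemma is_derive_dir (s : R -> R) (x v ds : R) :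
  is_derive x 1 s ds -> is_derive (x : R^o) (v : R^o) s (v * ds).
Proof.
move=> Ds.
have := @is_derive_comp R^o id s x v v ds.
by apply=> //; exact: is_derive_id.
Qed.

Lemma is_derive_add V (f g : V -> R) p d df dg :
  is_derive p d f df -> is_derive p d g dg ->
  is_derive p d (fun y => f y + g y : R) (df + dg).
Proof. by move=> Df Dg; apply: is_deriveD. Qed.

Lemma is_derive_mul V (f g : V -> R) p d df dg :
  is_derive p d f df -> is_derive p d g dg ->
  is_derive p d (fun y => f y * g y : R) (df * g p + f p * dg).
Proof.
by move=> Df Dg; apply: is_derive_eq; rewrite /GRing.scale /= addrC mulrC.
Qed.

Lemma is_derive_const V (c : R) (p d : V) : is_derive p d (fun=> c : R) 0.
Proof. exact: is_derive_cst. Qed.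

Lemma is_derive_inv V (f : V -> R) p d df :
  f p != 0 -> is_derive p d f df ->
  is_derive p d (fun y => (f y)^-1 : R) (- (f p) ^- 2 * df).
Proof.
move=> f0 [Df <-]; split; first exact: derivableV.
exact: deriveV.
Qed.

Lemma is_derive_coord n (i : 'I_n) (x v : 'rV[R]_n) :
  is_derive x v (fun y => y 0 i : R) (v 0 i).
Proof.
have /derivable_mxP/(_ 0 i) d := @derivable_id _ _ x v.
split; first exact: d.
have /(congr1 (fun M : 'rV[R]_n => M 0 i)) := derive_mx (@derivable_id _ _ x v).
by rewrite derive_id mxE.
Qed.

Lemma derive_row_mx n V (f : V -> 'rV[R]_n) (h : V -> R)
    x v (df : 'rV[R]_n) dh :
  (forall j, is_derive x v (fun y => f y 0 j : R) (df 0 j)) ->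
  is_derive x v h dh ->
  'D_v (fun y => row_mx (f y) (h y)%:M : 'rV[R]_(n + 1)) x = row_mx df dh%:M.
Proof.
move=> Df Dh.
have D j : is_derive x v (fun y => row_mx (f y) (h y)%:M 0 j : R)
    (row_mx df dh%:M 0 j).
  case: (split_ordP j) => k ->.
    under eq_fun do rewrite row_mxEl.
    by rewrite row_mxEl; exact: Df.
  under eq_fun do rewrite row_mxEr mxE ord1 mulr1n.
  by rewrite row_mxEr mxE ord1 mulr1n.
rewrite derive_mx.
  by apply/matrixP => a j; rewrite mxE ord1; have [_ ->] := D j.
by apply/derivable_mxP => a j; rewrite ord1; have [] := D j.
Qed.

End Derivatives.

Section Smooth.
Variable R : realType.
Implicit Types (V : normedModType R).

Section Ck.
Variables (V : normedModType R) (U : set V).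

Lemma Ck_weak k (h : V -> R^o) : Ck_on U k.+1 h -> Ck_on U k h.
Proof.
elim: k h => [|k IH] h [hc hd]; split=> // v.
by have [d /IH] := hd v.
Qed.

Lemma Ck_cont k (h : V -> R^o) :
  Ck_on U k h -> forall x, U x -> {for x, continuous h}.
Proof. by case: k => [|k] []. Qed.

Hypothesis oU : open U.

Lemma Ck_eq k (h h' : V -> R^o) :
  (forall x, U x -> h x = h' x) -> Ck_on U k h -> Ck_on U k h'.
Proof.
(* On an open set, pointwise equality is equality near each point, which derivatives respect. *)
move=> e0; have e x : U x -> {near x, h =1 h'}.
  by move=> Ux; apply: filterS e0 _; exact: (open_nbhs_nbhs (conj oU Ux)).
elim: k h h' {e0} e => [|k IH] h h' e [hc hd]; split => //; try move=> x Ux.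
- have E := e x Ux; rewrite /prop_for /continuous_at.
  rewrite -(nbhs_singleton E); apply: cvg_trans (hc x Ux).
  exact: near_eq_cvg.
- have E := e x Ux; rewrite /prop_for /continuous_at.
  rewrite -(nbhs_singleton E); apply: cvg_trans (hc x Ux).
  exact: near_eq_cvg.
- move=> v; have [d D] := hd v; split.
    by move=> x Ux; apply: near_eq_derivable (d x Ux); exact: e.
  apply: IH D => x Ux; apply: filterS (open_nbhs_nbhs (conj oU Ux)) => y Uy.
  by apply: near_eq_derive; exact: e.
Qed.

(** Introduction rule for [Ck_on]: the derivative may be given by an explicit formula valid on [U]
    only. *)
Lemma CkS k (h : V -> R^o) (dh : V -> V -> R^o) :
  (forall v x, U x -> is_derive x v h (dh v x)) ->
  (forall x, U x -> {for x, continuous h}) ->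
  (forall v, Ck_on U k (dh v)) -> Ck_on U k.+1 h.
Proof.
move=> D hc C; split=> // v; split=> [x /(D v)//|].
by apply: Ck_eq (C v) => x /(D v)[_ ->].
Qed.

Lemma Ck_cst k (c : R) : Ck_on U k (cst c : V -> R^o).
Proof.
elim: k c => [|k IH] c; first by split=> // x _; exact: cvg_cst.
apply: (@CkS _ _ (fun _ => cst 0)) => //; last by move=> x _; exact: cvg_cst.
Qed.

Lemma Ck_D k (f g : V -> R^o) :
  Ck_on U k f -> Ck_on U k g -> Ck_on U k (fun x => f x + g x).
Proof.
elim: k f g => [|k IH] f g [fc fd] [gc gd].
  by split=> // x Ux; apply: cvgD; [exact: fc|exact: gc].
apply: (@CkS _ _ (fun v x => 'D_v f x + 'D_v g x)).
- move=> v x Ux; apply: is_deriveD; apply: derivableP.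
    by have [d _] := fd v; exact: d.
  by have [d _] := gd v; exact: d.
- by move=> x Ux; apply: cvgD; [exact: fc|exact: gc].
- by move=> v; apply: IH; [have [] := fd v|have [] := gd v].
Qed.

Lemma Ck_M k (f g : V -> R^o) :
  Ck_on U k f -> Ck_on U k g -> Ck_on U k (fun x => f x * g x : R^o).
Proof.
elim: k f g => [|k IH] f g Cf Cg; have [fc fd] := Cf; have [gc gd] := Cg.
  by split=> // x Ux; apply: cvgM; [exact: fc|exact: gc].
apply: (@CkS _ _ (fun v x => f x * 'D_v g x + g x * 'D_v f x)).
- move=> v x Ux; apply: is_deriveM; apply: derivableP.
    by have [d _] := fd v; exact: d.
  by have [d _] := gd v; exact: d.
- by move=> x Ux; apply: cvgM; [exact: fc|exact: gc].
- move=> v; apply: Ck_D; apply: IH; try exact: Ck_weak.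
    by have [] := gd v.
  by have [] := fd v.
Qed.

Lemma Ck_X k n (f : V -> R^o) :
  Ck_on U k f -> Ck_on U k (fun x => f x ^+ n : R^o).
Proof.
move=> Cf; elim: n => [|n IH]; first exact: Ck_cst.
by under [X in Ck_on _ _ X]eq_fun do rewrite exprS; exact: Ck_M.
Qed.

Lemma Ck_sum k n (f : 'I_n -> V -> R^o) :
  (forall i, Ck_on U k (f i)) -> Ck_on U k (fun x => \sum_i f i x : R^o).
Proof.
elim: n f => [|n IH] f Cf.
  by under [X in Ck_on _ _ X]eq_fun do rewrite big_ord0; exact: Ck_cst.
under [X in Ck_on _ _ X]eq_fun do rewrite big_ord_recl.
by apply: Ck_D => //; apply: IH.
Qed.

End Ck.

(** The derivative is a product of ['D_v f] with a composition of the same kind, with [s'] in place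
    of [s]. Hence the induction ranges over all [s], and [s] is smooth at every order rather than of
    class [k]. *)
Lemma Ck_comp V (U : set V) (D : set R) k (s : R^o -> R^o) (f : V -> R^o) :
  open U -> open D -> (forall x, U x -> D (f x)) ->
  smooth_on (D : set R^o) s -> Ck_on U k f -> Ck_on U k (fun x => s (f x)).
Proof.
move=> oU oD fD; elim: k s f fD => [|k IH] s f fD Cs Cf.
  split=> // x Ux; apply: continuous_comp; first exact: (Ck_cont Cf).
  exact: (Ck_cont (Cs 0%N) (fD _ Ux)).
have [fc fd] := Cf.
apply: (@CkS _ _ oU _ _ (fun v x => 'D_v f x * 'D_1 s (f x) : R^o)).
- move=> v x Ux; apply: is_derive_comp; apply: derivableP.
    by have [d _] := fd v; exact: d.
  by have [_ /(_ 1)[d _]] := Cs 1%N; apply: d; exact: fD.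
- move=> x Ux; apply: continuous_comp; first exact: (Ck_cont Cf).
  exact: (Ck_cont (Cs 0%N) (fD _ Ux)).
- move=> v; apply: Ck_M => //; first by have [] := fd v.
  apply: (IH (fun y => 'D_1 s y : R^o) f fD); last exact: Ck_weak.
  by move=> j; have [_ /(_ 1)[_]] := Cs j.+1.
Qed.

Lemma smooth_sin_cos :
  smooth_on setT (@sin R : R^o -> R^o) /\ smooth_on setT (@cos R : R^o -> R^o).
Proof.
suff H k : Ck_on setT k (@sin R : R^o -> R^o) /\
    Ck_on setT k (@cos R : R^o -> R^o).
  by split=> k; have [] := H k.
have cs (x : R^o) : setT x -> {for x, continuous (@sin R : R^o -> R^o)}.
  by move=> _; exact: continuous_sin.
have cc (x : R^o) : setT x -> {for x, continuous (@cos R : R^o -> R^o)}.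
  by move=> _; exact: continuous_cos.
elim: k => [|k [IHs IHc]]; first by split; split.
split.
  apply: (@CkS R^o _ openT k (@sin R : R^o -> R^o)
    (fun v x => v * cos x : R^o)) => //.
    by move=> v x _; exact: is_derive_dir.
  by move=> v; apply: Ck_M => //; [exact: openT|exact/Ck_cst/openT].
apply: (@CkS R^o _ openT k (@cos R : R^o -> R^o)
    (fun v x => v * (- 1 * sin x) : R^o)) => //.
  by move=> v x _; rewrite mulN1r; exact: is_derive_dir.
by move=> v; do 2 (apply: Ck_M => //; try exact: openT; try exact/Ck_cst/openT).
Qed.

Lemma open_neq0 : open ([set x | x != 0] : set R^o).
Proof. exact: open_neq. Qed.

Lemma smooth_inv :
  smooth_on ([set x | x != 0] : set R^o) (GRing.inv : R^o -> R^o).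
Proof.
have ct (x : R^o) : x != 0 -> {for x, continuous (GRing.inv : R^o -> R^o)}.
  exact: inv_continuous.
elim=> [|k IH]; first by split.
apply: (@CkS R^o _ open_neq0 k (GRing.inv : R^o -> R^o)
  (fun v x => v * (- 1 * x^-1 ^+ 2) : R^o)) => //.
  move=> v x x0; apply: is_derive_dir.
  have D : derivable (@id R) x 1 by exact: derivable_id.
  split; first exact: (derivableV x0 D).
  rewrite (deriveV x0 D) (derive_id x).
  by rewrite exprVn mulN1r /GRing.scale /= mulr1.
have o := open_neq0.
by move=> v; do 2 (apply: Ck_M => //; try exact/Ck_cst); exact: Ck_X.
Qed.

Lemma Ck_V V (U : set V) k (f : V -> R^o) : open U ->
  (forall x, U x -> f x != 0) ->
  Ck_on U k f -> Ck_on U k (fun x => (f x)^-1 : R^o).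
Proof.
by move=> oU f0; apply: (Ck_comp oU open_neq0 f0); exact: smooth_inv.
Qed.

Lemma smooth_sqrt : smooth_on ([set x | 0 < x] : set R^o)
  (@Num.sqrt R : R^o -> R^o).
Proof.
have ct (x : R^o) : 0 < x -> {for x, continuous (@Num.sqrt R : R^o -> R^o)}.
  by move=> _; exact: sqrt_continuous.
have o : open ([set x | 0 < x] : set R^o) by exact: open_gt.
elim=> [|k IH]; first by split.
apply: (@CkS R^o _ o k (@Num.sqrt R : R^o -> R^o)
  (fun v x => v * (2 * Num.sqrt x)^-1 : R^o)) => //.
  by move=> v x x0; apply: is_derive_dir; exact: is_derive1_sqrt.
move=> v; apply: Ck_M => //; first exact/Ck_cst.
apply: Ck_V => //; first by move=> x x0; rewrite mulf_neq0// gt_eqF ?sqrtr_gt0.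
by apply: Ck_M => //; exact/Ck_cst.
Qed.

Lemma Ck_coord n k (i : 'I_n) :
  Ck_on setT k (fun x : 'rV[R]_n => x 0 i : R^o).
Proof.
have ct (x : 'rV[R]_n) : setT x ->
  {for x, continuous (fun x : 'rV[R]_n => x 0 i : R^o)}.
  by move=> _; exact: coord_continuous.
elim: k => [|k IH]; first by split.
apply: (@CkS 'rV[R]_n _ openT k (fun x => x 0 i : R^o)
  (fun v _ => v 0 i : R^o)) => //.
  by move=> v x _; exact: is_derive_coord.
by move=> v; exact/Ck_cst/openT.
Qed.

End Smooth.

(** * Curvature of radial metrics *)

Section DotProduct.
Variables (R : realType) (n : nat).
Implicit Types (x u v : 'rV[R]_n).

Lemma dotpE u v : dotp u v = \sum_i u 0 i * v 0 i.
Proof. by rewrite /dotp mxE; apply: eq_bigr => i _; rewrite mxE. Qed.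

Lemma dotpC u v : dotp u v = dotp v u.
Proof. by rewrite !dotpE; apply: eq_bigr => i _; rewrite mulrC. Qed.

Lemma dotpDl u u' v :
  dotp (u + u') v = dotp u v + dotp u' v.
Proof. by rewrite /dotp mulmxDl mxE. Qed.

Lemma dotpZl a u v : dotp (a *: u) v = a * dotp u v.
Proof. by rewrite /dotp -scalemxAl mxE. Qed.

Lemma dotpDr u v v' :
  dotp u (v + v') = dotp u v + dotp u v'.
Proof. by rewrite dotpC dotpDl !(dotpC u). Qed.

Lemma dotpZr a u v : dotp u (a *: v) = a * dotp u v.
Proof. by rewrite dotpC dotpZl (dotpC u). Qed.

Lemma dotp0l v : dotp 0 v = 0.
Proof. by rewrite /dotp mul0mx mxE. Qed.

Lemma dotp_ge0 u : 0 <= dotp u u.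
Proof. by rewrite dotpE sumr_ge0// => i _; rewrite -expr2 sqr_ge0. Qed.

Lemma dotp_gt0 u : u != 0 -> 0 < dotp u u.
Proof.
move=> u0; rewrite lt_def dotp_ge0 andbT; apply: contra u0.
rewrite dotpE psumr_eq0; last by move=> i _; rewrite -expr2 sqr_ge0.
move=> /allP h; apply/eqP/rowP => i; rewrite mxE.
by have := h i (mem_index_enum i); rewrite mulf_eq0 orbb => /eqP.
Qed.

End DotProduct.

Section RadialMetric.
Variables (R : realType) (n : nat).
Implicit Types (x y u v : 'rV[R]_n) (i j k l m : 'I_n).

Definition kron i j : R := (i == j)%:R.

Lemma kronC i j : kron i j = kron j i.
Proof. by rewrite /kron eq_sym. Qed.

Lemma sum_kron i (F : 'I_n -> R) : \sum_m kron i m * F m = F i.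
Proof.
rewrite (bigD1 i)//= /kron eqxx mul1r big1 ?addr0// => m mi.
by rewrite eq_sym (negPf mi) mul0r.
Qed.

Lemma dotp_delta i x : dotp (delta_mx 0 i) x = x 0 i.
Proof.
rewrite dotpE -[RHS]sum_kron; apply: eq_bigr => m _.
by rewrite mxE eqxx eq_sym.
Qed.

(** Every contraction below pairs something with a combination of two basis vectors and [x]; when
    fewer vectors occur, the sum is padded with zero coefficients to match this shape. *)
Lemma sum_kron_coord i j x (al be ga : R) (F : 'I_n -> R) :
  \sum_m (al * kron i m + be * kron j m + ga * x 0 m) * F m =
  al * F i + be * F j + ga * \sum_m x 0 m * F m.
Proof.
rewrite -[F i]sum_kron -[F j]sum_kron !mulr_sumr -!big_split /=.
by apply: eq_bigr => m _; ring.
Qed.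

Lemma sum_coord_kron i j x (al be ga : R) :
  \sum_m x 0 m * (al * kron i m + be * kron j m + ga * x 0 m) =
  al * x 0 i + be * x 0 j + ga * dotp x x.
Proof.
under eq_bigr do rewrite mulrC.
by rewrite sum_kron_coord dotpE.
Qed.

Lemma is_derive_coord_delta i j x :
  is_derive x (delta_mx 0 i) (fun y => y 0 j : R) (kron i j).
Proof.
by have := is_derive_coord j x (delta_mx 0 i); rewrite mxE eqxx eq_sym.
Qed.

(* [F1] is twice the derivative of [F] with respect to [dotp x x]. *)
Definition radial_derive (F F1 : 'rV[R]_n -> R) :=
  forall x i, is_derive x (delta_mx 0 i) F (F1 x * x 0 i).

Lemma partial_is_derive i (h : 'rV[R]_n -> R) x d :
  is_derive x (delta_mx 0 i) h d -> partial i h x = d.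
Proof. by case. Qed.

Definition radial_metric (A B : 'rV[R]_n -> R) x : 'M[R]_n :=
  \matrix_(i, j) (A x * kron i j + B x * x 0 i * x 0 j).

Ltac derive_tac := repeat (first
  [ exact: is_derive_const | exact: is_derive_coord_delta
  | match goal with H : radial_derive ?A _ |- is_derive _ _ ?A _ => exact: H end
  | match goal with H : radial_derive ?A _ |-
      is_derive _ _ (fun y => ?A y) _ => exact: H end
  | apply: is_derive_add | apply: is_derive_mul ]).

Section Curvature.
Variables A A1 B B1 a a1 b b1 c c1 : 'rV[R]_n -> R.
Hypotheses (dA : radial_derive A A1) (dB : radial_derive B B1).
Hypotheses (da : radial_derive a a1) (db : radial_derive b b1).
Hypothesis dc : radial_derive c c1.
Let G := radial_metric A B.
Let rho x := dotp x x.
Let D x := A x + B x * rho x.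
Hypotheses (A0 : forall x, A x != 0) (D0 : forall x, D x != 0).
(* Lowering the first index of [gamma] below yields the Christoffel symbols of the
   first kind exactly under [Ea], [Eb] and [Ec]. *)
Hypothesis Ea : forall x, 2 * (A x * a x) = A1 x.
Hypothesis Eb : forall x, 2 * (D x * b x) = 2 * B x - A1 x.
Hypothesis Ec : forall x, 2 * (D x * c x) = B1 x - 4 * a x * B x.

Let gamma k i j x :=
  a x * (x 0 i * kron j k + x 0 j * kron i k) +
  (b x * kron i j + c x * x 0 i * x 0 j) * x 0 k.

Lemma radial_metric_unit x : G x \in unitmx.
Proof.
(* Sherman-Morrison inverse of [A I + B x^T x]; [D x] is the eigenvalue of [G x] in the direction of
   [x]. *)
pose N : 'M[R]_n := \matrix_(i, j)
  ((A x)^-1 * kron i j - (A x)^-1 * (B x / D x) * x 0 i * x 0 j).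
suff /mulmx1_unit[] : G x *m N = 1%:M by [].
apply/matrixP => i j; rewrite !mxE.
rewrite (eq_bigr (fun m =>
  (A x * kron i m + 0 * kron i m + (B x * x 0 i) * x 0 m)
  * ((A x)^-1 * kron j m + 0 * kron j m +
     (- ((A x)^-1 * (B x / D x) * x 0 j)) * x 0 m))); last first.
  by move=> m _; rewrite !mxE (kronC m j); ring.
rewrite sum_kron_coord sum_coord_kron -/(kron i j) (kronC j i) -/(rho x).
have := D0 x; have := A0 x; rewrite /D => *; field.
by apply/andP.
Qed.

Lemma partial_radial_metric i j l x : partial i (fun y => G y j l) x =
  A1 x * x 0 i * kron j l + B1 x * x 0 i * x 0 j * x 0 l
  + B x * (kron i j * x 0 l + kron i l * x 0 j).
Proof.
apply: partial_is_derive.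
rewrite (_ : (fun y => _) = (fun y => A y * kron j l + B y * y 0 j * y 0 l));
  last by apply/funext => y; rewrite mxE.
apply: is_derive_eq; first by derive_tac.
by rewrite /=; ring.
Qed.

Lemma radial_christoffel k i j x : christoffel G k i j x = gamma k i j x.
Proof.
pose g := \col_k gamma k i j x.
(* Since [G x] is invertible, it suffices to compare the symbols with the upper index lowered, and
   the inverse matrix never has to be expanded. *)
suff E : \col_l (2^-1 * (partial i (fun y => G y j l) x
    + partial j (fun y => G y i l) x - partial l (fun y => G y i j) x)) =
    G x *m g.
  have -> : gamma k i j x = g k 0 by rewrite mxE.
  rewrite -[g in RHS]mul1mx -(mulVmx (radial_metric_unit x)) -mulmxA -E.
  rewrite mxE /christoffel mulr_sumr; apply: eq_bigr => l _.
  by rewrite !mxE mulrCA.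
apply/matrixP => l z; rewrite !mxE !partial_radial_metric.
rewrite (eq_bigr (fun m =>
  (A x * kron l m + 0 * kron l m + (B x * x 0 l) * x 0 m) *
  ((a x * x 0 i) * kron j m + (a x * x 0 j) * kron i m +
   (b x * kron i j + c x * x 0 i * x 0 j) * x 0 m))); last first.
  by move=> m _; rewrite !mxE /gamma; ring.
rewrite sum_kron_coord sum_coord_kron (kronC l i) (kronC l j) (kronC j i).
have := Ea x; have := Eb x; have := Ec x; rewrite /D -/(rho x) => e1 e2 e3.
have t0 : (2 : R) != 0 by rewrite pnatr_eq0.
apply: (mulfI t0); rewrite mulVKf//.
(* The terms are grouped so that the left-hand sides of [Ea], [Eb] and [Ec] occur verbatim. *)
transitivity (2 * (A x * a x) * (x 0 i * kron j l + x 0 j * kron i l) +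
   2 * ((A x + B x * rho x) * b x) * kron i j * x 0 l +
   (2 * ((A x + B x * rho x) * c x) + 4 * a x * B x) * x 0 i * x 0 j * x 0 l).
  by rewrite e1 e2 e3; ring.
by ring.
Qed.

(** Coefficients of the three terms that survive antisymmetrization in [i] and [j] in
    [radial_riemann_op]; symmetric terms, such as the one with [c1], cancel. *)
Definition radial_E x := b x - a x + a x * b x * rho x.
Definition radial_F x := c x - a1 x + a x ^+ 2 + a x * c x * rho x.
Definition radial_H x := b1 x - c x + b x ^+ 2 + b x * c x * rho x.

Lemma partial_gamma i l j k x : partial i (christoffel G l j k) x =
  a1 x * x 0 i * (x 0 j * kron k l + x 0 k * kron j l)
  + a x * (kron i j * kron k l + kron i k * kron j l)
  + (b1 x * x 0 i * kron j k + c1 x * x 0 i * x 0 j * x 0 k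
     + c x * (kron i j * x 0 k + kron i k * x 0 j)) * x 0 l
  + (b x * kron j k + c x * x 0 j * x 0 k) * kron i l.
Proof.
apply: partial_is_derive.
rewrite (_ : christoffel G l j k = gamma l j k);
  last by apply/funext => y; exact: radial_christoffel.
apply: is_derive_eq; first by rewrite /gamma; derive_tac.
by rewrite /=; ring.
Qed.

Lemma sum_gamma_gamma l i j k x :
  \sum_m gamma l i m x * gamma m j k x =
  a x * x 0 i * gamma l j k x + b x * x 0 l * gamma i j k x +
  (a x * kron i l + c x * x 0 i * x 0 l) *
  (2 * a x * x 0 j * x 0 k + (b x * kron j k + c x * x 0 j * x 0 k) * rho x).
Proof.
rewrite (eq_bigr (fun m =>
  ((a x * x 0 i) * kron l m + (b x * x 0 l) * kron i m +
  (a x * kron i l + c x * x 0 i * x 0 l) * x 0 m) * gamma m j k x)); last first.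
  by move=> m _; congr (_ * _); rewrite /gamma (kronC m l); ring.
rewrite sum_kron_coord; congr (_ + _ * _).
rewrite (eq_bigr (fun m => x 0 m * ((a x * x 0 j) * kron k m +
  (a x * x 0 k) * kron j m +
  (b x * kron j k + c x * x 0 j * x 0 k) * x 0 m))); last first.
  by move=> m _; rewrite /gamma; ring.
by rewrite sum_coord_kron -/(rho x); ring.
Qed.

Lemma radial_riemann_op l i j k x : riemann_op G l i j k x =
  radial_E x * (kron j k * kron i l - kron i k * kron j l)
  + radial_F x * x 0 k * (x 0 j * kron i l - x 0 i * kron j l)
  + radial_H x * x 0 l * (x 0 i * kron j k - x 0 j * kron i k).
Proof.
rewrite /riemann_op !partial_gamma sumrB.
have sumE i' j' : \sum_m christoffel G l i' m x * christoffel G m j' k x =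
    \sum_m gamma l i' m x * gamma m j' k x.
  by apply: eq_bigr => m _; rewrite !radial_christoffel.
rewrite !sumE !sum_gamma_gamma /gamma /radial_E /radial_F /radial_H.
rewrite (kronC k i) (kronC k j) (kronC j i) (kronC k l).
by ring.
Qed.

Lemma radial_riemann i j k l x : riemann G i j k l x =
  A x * (radial_E x * (kron j k * kron i l - kron i k * kron j l)
         + radial_F x * x 0 k * (x 0 j * kron i l - x 0 i * kron j l))
  + (D x * radial_H x + B x * radial_E x) * x 0 l
    * (x 0 i * kron j k - x 0 j * kron i k).
Proof.
rewrite /riemann.
rewrite (eq_bigr (fun m =>
  ((radial_E x * kron j k + radial_F x * x 0 k * x 0 j) * kron i m
   + (- (radial_E x * kron i k + radial_F x * x 0 k * x 0 i)) * kron j m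
   + (radial_H x * (x 0 i * kron j k - x 0 j * kron i k)) * x 0 m) *
  (A x * kron l m + 0 * kron l m + (B x * x 0 l) * x 0 m))); last first.
  by move=> m _; rewrite radial_riemann_op mxE (kronC m l); ring.
rewrite sum_kron_coord sum_coord_kron /D -/(rho x).
by rewrite (kronC l i) (kronC l j); ring.
Qed.

End Curvature.

End RadialMetric.

(** * The metric in stereographic coordinates *)

Section Profile.
Variables (R : realType) (r : nat).

(** The [Q] of the overview, with [r + 1 = q - 1] terms; a polynomial, so that its formal derivative
    is at hand. Likewise [geomS] below is [P]. *)
Definition geom : {poly R} := \sum_(k < r.+1) 'X^k.

Lemma geom_mul (s : R) : (1 - s) * geom.[s] = 1 - s ^+ r.+1.
Proof.
rewrite -[RHS]opprB subrX1 -mulNr opprB /geom horner_sum; congr (_ * _).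
by apply: eq_bigr => k _; rewrite hornerXn.
Qed.

Lemma geom_deriv_mul (s : R) :
  (1 - s) * geom^`().[s] = geom.[s] - r.+1%:R * s ^+ r.
Proof.
have /(congr1 (fun p : {poly R} => p^`().[s])) :
    (1 - 'X) * geom = 1 - 'X^(r.+1).
  rewrite -[RHS]opprB subrX1 -mulNr opprB /geom; congr (_ * _).
rewrite derivM !derivB !derivC derivX derivXn !hornerE /= => e.
rewrite hornerMn hornerXn -mulr_natl in e.
by lra.
Qed.

Lemma geom_ge0 (s : R) : 0 <= s -> 0 <= geom.[s].
Proof.
move=> s0; rewrite /geom horner_sum; apply: sumr_ge0 => k _.
by rewrite hornerXn exprn_ge0.
Qed.

Definition geomS (s : R) := 1 + s * geom.[s].

Lemma geomS_ge1 (s : R) : 0 <= s -> 1 <= geomS s.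
Proof. by move=> s0; rewrite lerDl mulr_ge0// geom_ge0. Qed.

Lemma geomS_gt0 (s : R) : 0 <= s -> 0 < geomS s.
Proof. by move=> /geomS_ge1; apply: lt_le_trans. Qed.

End Profile.

Section RadialDerive.
Variables (R : realType) (n : nat).
Implicit Types (F H : 'rV[R]_n -> R) (x : 'rV[R]_n).

Lemma radial_derive_eq F F1 F2 :
  radial_derive F F1 -> (forall x, F1 x = F2 x) -> radial_derive F F2.
Proof. by move=> dF e x i; rewrite -e. Qed.

Lemma radial_derive_cst (c : R) :
  radial_derive (fun=> c) (fun _ : 'rV[R]_n => 0).
Proof. by move=> x i; rewrite mul0r; exact: is_derive_const. Qed.

Lemma radial_derive_add F F1 H H1 : radial_derive F F1 -> radial_derive H H1 ->
  radial_derive (fun x => F x + H x) (fun x => F1 x + H1 x).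
Proof. by move=> dF dH x i; rewrite mulrDl; exact: is_derive_add. Qed.

Lemma radial_derive_mul F F1 H H1 : radial_derive F F1 -> radial_derive H H1 ->
  radial_derive (fun x => F x * H x) (fun x => F1 x * H x + F x * H1 x).
Proof.
move=> dF dH x i; apply: is_derive_eq; first exact: is_derive_mul.
by rewrite /=; ring.
Qed.

Lemma radial_derive_inv F F1 : (forall x, F x != 0) -> radial_derive F F1 ->
  radial_derive (fun x => (F x)^-1) (fun x => - (F x) ^- 2 * F1 x).
Proof.
move=> F0 dF x i; apply: is_derive_eq; first exact: is_derive_inv.
by rewrite /= mulrA.
Qed.

Lemma radial_derive_horner (p : {poly R}) F F1 : radial_derive F F1 ->
  radial_derive (fun x => p.[F x]) (fun x => p^`().[F x] * F1 x).
Proof.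
move=> dF x i; apply: is_derive_eq.
  by apply: (is_derive_comp (dF x i)); exact: is_derive_poly.
by rewrite mulrC mulrA.
Qed.

Lemma radial_derive_dotp :
  radial_derive (fun x => dotp x x) (fun _ : 'rV[R]_n => 2).
Proof.
move=> x i.
rewrite (_ : (fun x => _) = \sum_(j < n) (fun x : 'rV[R]_n => x 0 j * x 0 j));
  last by apply/funext => y; rewrite dotpE fct_sumE.
apply: is_derive_eq.
  apply: is_derive_sum => j.
  by apply: is_derive_mul; exact: is_derive_coord_delta.
rewrite /= -[x 0 i in RHS]sum_kron mulr_sumr.
by apply: eq_bigr => j _; ring.
Qed.

End RadialDerive.

Section Chart.
Variables (R : realType) (n r : nat).
Implicit Types (x u v : 'rV[R]_n).
Let Q : {poly R} := geom R r.
Let P : R -> R := @geomS R r.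

(** Conformal factor of the stereographic chart: the round metric is [wght ^+ 2] times the Euclidean
    one. All radial quantities are expressed through it, because [dotp x x = (2 - wght x) / wght x]
    and the height is [1 - wght x] up to sign. This puts the identities below within reach of
    [field]. *)
Definition wght x : R := 2 * (dotp x x + 1)^-1.
(* [sin^2] of the distance to the pole for the round metric *)
Definition sinsq x : R := wght x * (2 - wght x).
Definition chart_A x := wght x ^+ 2.
(** The height satisfies [dz = wght^2 <x, dx>] up to sign, whence the fourth power in
    [- (Q / P) dz^2]. *)
Definition chart_B x := - (wght x ^+ 4 * Q.[sinsq x] / P (sinsq x)).

Lemma dotp1_gt0 x : 0 < dotp x x + 1.
Proof. by rewrite ltr_wpDl// dotp_ge0. Qed.

Lemma wght_gt0 x : 0 < wght x.
Proof. by rewrite mulr_gt0// invr_gt0 dotp1_gt0. Qed.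

Lemma wght_neq0 x : wght x != 0.
Proof. by rewrite gt_eqF// wght_gt0. Qed.

Lemma dotp_wght x : wght x * dotp x x = 2 - wght x.
Proof. by rewrite /wght; have := dotp1_gt0 x => /gt_eqF/negbT ?; field. Qed.

Lemma sinsqE x : sinsq x = wght x ^+ 2 * dotp x x.
Proof. by rewrite expr2 -mulrA dotp_wght. Qed.

Lemma sinsq_ge0 x : 0 <= sinsq x.
Proof. by rewrite sinsqE mulr_ge0 ?sqr_ge0 ?dotp_ge0. Qed.

Lemma radial_derive_wght : radial_derive wght (fun x => - wght x ^+ 2).
Proof.
have d1 := radial_derive_add (@radial_derive_dotp R n)
  (@radial_derive_cst R n 1).
have n0 x : dotp x x + 1 != 0 by rewrite gt_eqF// dotp1_gt0.
have d2 := radial_derive_mul (@radial_derive_cst R n 2)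
  (radial_derive_inv n0 d1).
apply: radial_derive_eq d2 _ => x /=.
by rewrite /wght; have ? := n0 x; field.
Qed.

Lemma radial_derive_sinsq :
  radial_derive sinsq (fun x => - 2 * (1 - wght x) * wght x ^+ 2).
Proof.
have dw := radial_derive_wght.
have d := radial_derive_mul dw (radial_derive_add (@radial_derive_cst R n 2)
  (radial_derive_mul (@radial_derive_cst R n (-1)) dw)).
rewrite (_ : sinsq = (fun x => wght x * (2 + -1 * wght x))); last first.
  by apply/funext => y; rewrite /sinsq mulN1r.
by apply: radial_derive_eq d _ => y /=; ring.
Qed.

Let s1 x := - 2 * (1 - wght x) * wght x ^+ 2.
Let P1 x := s1 x * (Q.[sinsq x] + sinsq x * Q^`().[sinsq x]).

Lemma radial_derive_geomS : radial_derive (fun x => P (sinsq x)) P1.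
Proof.
have ds := radial_derive_sinsq.
have d := radial_derive_add (@radial_derive_cst R n 1)
  (radial_derive_mul ds (radial_derive_horner Q ds)).
by apply: radial_derive_eq d _ => x; rewrite /P1 /s1 /=; ring.
Qed.

Lemma geomS_sinsq_neq0 x : P (sinsq x) != 0.
Proof. by rewrite gt_eqF// geomS_gt0// sinsq_ge0. Qed.

(** Solutions of [Ea], [Eb] and [Ec] for [chart_A] and [chart_B], written with sums, products and
    inverses only so that the [radial_derive] rules apply to them. *)
Let a x := - 1 * wght x.
Let b x := wght x * P (sinsq x) + - 1 * wght x * wght x * Q.[sinsq x].
Let c x := wght x * wght x * wght x * wght x * (1 + - 1 * wght x) *
  (Q^`().[sinsq x] + - 1 * Q.[sinsq x] * Q.[sinsq x]) * (P (sinsq x))^-1.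

Definition chart_metric := radial_metric chart_A chart_B.

(** The first coefficient is [chart_A ^+ 2] times the curvature of the planes orthogonal to [x]; the
    second term is the correction for the other planes. *)
Lemma chart_riemann i j k l x : riemann chart_metric i j k l x =
  wght x ^+ 4 * sinsq x ^+ r.+1 *
    (kron R j k * kron R i l - kron R i k * kron R j l)
  + wght x ^+ 6 * (r.+1%:R * sinsq x ^+ r - Q.[sinsq x] * sinsq x ^+ r.+1)
    / P (sinsq x) *
    (x 0 k * x 0 j * kron R i l - x 0 k * x 0 i * kron R j l +
     x 0 l * x 0 i * kron R j k - x 0 l * x 0 j * kron R i k).
Proof.
have dw := radial_derive_wght; have ds := radial_derive_sinsq.
have dP := radial_derive_geomS; have diP := radial_derive_inv geomS_sinsq_neq0 dP.
have dQ := radial_derive_horner Q ds.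
have dQ' := radial_derive_horner Q^`() ds.
have d1 := @radial_derive_cst R n (1 : R).
have dN := @radial_derive_cst R n (-1 : R).
have M := @radial_derive_mul R n; have D := @radial_derive_add R n.
have dA : radial_derive chart_A _ := M _ _ _ _ dw dw.
have dB : radial_derive chart_B (fun x =>
  - (- 4 * wght x ^+ 5 * Q.[sinsq x] / P (sinsq x)
     + wght x ^+ 4 * (Q^`().[sinsq x] * s1 x / P (sinsq x)
       - Q.[sinsq x] * P1 x / P (sinsq x) ^+ 2))).
  have d := M _ _ _ _ (M _ _ _ _ (M _ _ _ _ dN (M _ _ _ _ (M _ _ _ _ dw dw)
    (M _ _ _ _ dw dw))) dQ) diP.
  rewrite (_ : chart_B = (fun x => - 1 * (wght x * wght x * (wght x * wght x)) *
     Q.[sinsq x] / P (sinsq x))); last first.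
    by apply/funext => y; rewrite /chart_B; ring.
  by apply: radial_derive_eq d _ => y /=; rewrite /s1;
    have ? := geomS_sinsq_neq0 y; field.
have da : radial_derive a _ := M _ _ _ _ dN dw.
have db : radial_derive b _ := D _ _ _ _ (M _ _ _ _ dw dP)
  (M _ _ _ _ (M _ _ _ _ (M _ _ _ _ dN dw) dw) dQ).
have dc : radial_derive c _ := M _ _ _ _ (M _ _ _ _ (M _ _ _ _ (M _ _ _ _
   (M _ _ _ _ (M _ _ _ _ dw dw) dw) dw) (D _ _ _ _ d1 (M _ _ _ _ dN dw)))
   (D _ _ _ _ dQ' (M _ _ _ _ (M _ _ _ _ dN dQ) dQ))) diP.
have rhoE y : dotp y y = (2 - wght y) / wght y.
  by rewrite -dotp_wght mulrAC divff ?mul1r// wght_neq0.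
have A0 y : chart_A y != 0 by rewrite expf_neq0// wght_neq0.
(* Radial eigenvalue of the metric: [1 - s Q / P = 1 / P], the factor of [d phi^2] in the
   overview. *)
have DE y : chart_A y + chart_B y * dotp y y = wght y ^+ 2 / P (sinsq y).
  have := geomS_sinsq_neq0 y; have := wght_neq0 y; rewrite /chart_A /chart_B rhoE.
  rewrite /P /geomS /sinsq => ? ?; field.
  by apply/andP.
have D0 y : chart_A y + chart_B y * dotp y y != 0.
  by rewrite DE mulf_neq0 ?invr_neq0 ?geomS_sinsq_neq0// expf_neq0// wght_neq0.
have sE1 := geom_mul r (sinsq x); have sE2 := geom_deriv_mul r (sinsq x).
rewrite (radial_riemann dA dB da db dc A0 D0); first last.
- move=> y; rewrite DE /a /c /chart_B /s1 /P1; have := geomS_sinsq_neq0 y.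
  rewrite /P /geomS /s1 /sinsq => ?; field.
  by [].
- move=> y; rewrite DE /b /chart_B; have := geomS_sinsq_neq0 y.
  rewrite /P /geomS /s1 /sinsq => ?; field.
  by [].
- by move=> y; rewrite /a /chart_A; ring.
rewrite -/Q in sE1 sE2.
(* Both powers of [sinsq x] are traded for values of [Q] and its derivative, so that only rational
   identities in [wght x] and these two values remain. *)
have -> : r.+1%:R * sinsq x ^+ r =
    Q.[sinsq x] - (1 - sinsq x) * Q^`().[sinsq x].
  by rewrite sE2; ring.
have -> : sinsq x ^+ r.+1 = 1 - (1 - sinsq x) * Q.[sinsq x].
  by rewrite sE1; ring.
set E := radial_E _ _ _; set F := radial_F _ _ _ _; set H := radial_H _ _ _ _.
have EE : chart_A x * E = wght x ^+ 4 * (1 - (1 - sinsq x) * Q.[sinsq x]).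
  rewrite /E /radial_E rhoE /chart_A /a /b /P /geomS /sinsq.
  by have ? := wght_neq0 x; field.
have FE : chart_A x * F = wght x ^+ 6 * (Q.[sinsq x] -
    (1 - sinsq x) * Q^`().[sinsq x] - Q.[sinsq x] *
    (1 - (1 - sinsq x) * Q.[sinsq x])) / P (sinsq x).
  have := geomS_sinsq_neq0 x; have := wght_neq0 x.
  rewrite /F /radial_F rhoE /chart_A /a /c /P /geomS /sinsq => ? ?; field.
  by apply/andP.
(* This equality is the antisymmetry of the curvature tensor in [k] and [l]; it merges the two mixed
   terms of [radial_riemann]. *)
have HE :
    (chart_A x + chart_B x * dotp x x) * H + chart_B x * E = chart_A x * F.
  rewrite FE DE.
  have := geomS_sinsq_neq0 x; have := wght_neq0 x.
  rewrite /H /E /radial_H /radial_E rhoE /chart_B /a /b /c /P1 /s1.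
  rewrite /P /geomS /sinsq => ? ?; field.
  by apply/andP.
by rewrite HE mulrDr !mulrA EE FE; ring.
Qed.

End Chart.

(** * Sectional curvatures in a chart and their extremal planes *)

Section Sectional.
Variables (R : realType) (n r : nat).
Implicit Types (x u v : 'rV[R]_n).
Let Q : {poly R} := geom R r.
Let P : R -> R := @geomS R r.

Definition gram u v : R := dotp u u * dotp v v - dotp u v ^+ 2.

(* [| <x,v> u - <x,u> v |^2] *)
Definition gram_along x u v : R := dotp x v ^+ 2 * dotp u u
  + dotp x u ^+ 2 * dotp v v - 2 * dotp x u * dotp x v * dotp u v.

Let dotp_bilE := (dotpDl, dotpDr, dotpZl, dotpZr).

Lemma gram_along_ge0 x u v : 0 <= gram_along x u v.
Proof.
have := dotp_ge0 (dotp x v *: u + (- dotp x u) *: v).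
rewrite !dotp_bilE (dotpC v u) [leRHS](_ : _ = gram_along x u v)//.
by rewrite /gram_along; ring.
Qed.

(** Strict Cauchy-Schwarz: [dotp u u * gram u v] is the squared norm of
    [dotp u u *: v - dotp u v *: u], which is nonzero by independence. *)
Lemma gram_gt0 u v : row_free (col_mx u v) -> 0 < gram u v.
Proof.
move=> uv.
have ind (a b : R) : a *: u + b *: v = 0 -> a = 0 /\ b = 0.
  move=> e; have /(row_free_inj uv) E : row_mx a%:M b%:M *m col_mx u v =
      (0 : 'rV[R]_(1 + 1)) *m col_mx u v.
    by rewrite mul0mx mul_row_col !mul_scalar_mx.
  split.
    have /(congr1 (fun M : 'rV[R]_(1 + 1) => M 0 (lshift 1 0))) := E.
    by rewrite row_mxEl !mxE eqxx mulr1n.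
  have /(congr1 (fun M : 'rV[R]_(1 + 1) => M 0 (rshift 1 0))) := E.
  by rewrite row_mxEr !mxE eqxx mulr1n.
have u0 : u != 0.
  apply/eqP => u0; have [|/eqP + _] := @ind 1 0.
    by rewrite u0 scaler0 scale0r addr0.
  by rewrite oner_eq0.
have := dotp_gt0 u0 => uu.
have z0 : (- dotp u v) *: u + dotp u u *: v != 0.
  by apply/eqP => /ind[_ e]; rewrite e ltxx in uu.
have := dotp_gt0 z0; rewrite !dotp_bilE (dotpC v u).
rewrite [ltRHS](_ : _ = dotp u u * gram u v); last by rewrite /gram; ring.
by rewrite pmulr_rgt0.
Qed.

(* The Gram determinant of [x], [u], [v] is nonnegative: the vector below is
   [gram u v] times the component of [x] orthogonal to [u] and [v]. *)
Lemma gram_along_le x u v : 0 < gram u v ->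
  gram_along x u v <= dotp x x * gram u v.
Proof.
move=> G0.
have := dotp_ge0 (gram u v *: x
  + (dotp x v * dotp u v - dotp x u * dotp v v) *: u
  + (dotp x u * dotp u v - dotp x v * dotp u u) *: v).
rewrite !dotp_bilE (dotpC u x) (dotpC v x) (dotpC v u).
rewrite [leRHS](_ : _ = gram u v * (dotp x x * gram u v - gram_along x u v)).
  by rewrite pmulr_rge0// subr_ge0.
by rewrite /gram_along /gram; ring.
Qed.

Lemma sum_lin3 (p q t : R) (f g h : 'I_n -> R) :
  \sum_m (p * f m + q * g m + t * h m) =
  p * \sum_m f m + q * \sum_m g m + t * \sum_m h m.
Proof. by rewrite !mulr_sumr -!big_split. Qed.

Lemma bilin_radial (A B : 'rV[R]_n -> R) x u v :
  bilin (radial_metric A B x) u v =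
  A x * dotp u v + B x * dotp x u * dotp x v.
Proof.
rewrite /bilin mxE.
have uE j : (u *m radial_metric A B x) 0 j =
    A x * u 0 j + B x * dotp x u * x 0 j.
  rewrite mxE (eq_bigr (fun m => (A x * kron R j m + 0 * kron R j m
    + (B x * x 0 j) * x 0 m) * u 0 m)); last first.
    by move=> m _; rewrite mxE (kronC R j m); ring.
  by rewrite sum_kron_coord -dotpE; ring.
rewrite (eq_bigr (fun m => A x * (u 0 m * v 0 m)
  + (B x * dotp x u) * (x 0 m * v 0 m) + 0 * 0)); last first.
  by move=> m _; rewrite uE !mxE; ring.
by rewrite sum_lin3 mul0r addr0 -!dotpE.
Qed.

Lemma sum_riemann_form (al be : R) x u v :
  \sum_i \sum_j \sum_k \sum_l
    (al * (kron R j k * kron R i l - kron R i k * kron R j l) + be *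
     (x 0 k * x 0 j * kron R i l - x 0 k * x 0 i * kron R j l +
      x 0 l * x 0 i * kron R j k - x 0 l * x 0 j * kron R i k))
    * u 0 i * v 0 j * v 0 k * u 0 l =
  al * gram u v + be * gram_along x u v.
Proof.
pose xu := dotp x u; pose xv := dotp x v.
(* The sums are evaluated from the inside out; this is the shape after the sum over [l]. *)
transitivity (\sum_i u 0 i * \sum_j v 0 j * \sum_k
  ((al * u 0 i + be * xu * x 0 i) * kron R j k +
   (- (al * u 0 j + be * xu * x 0 j)) * kron R i k +
   be * (x 0 j * u 0 i - x 0 i * u 0 j) * x 0 k) * v 0 k).
  apply: eq_bigr => i _; rewrite mulr_sumr; apply: eq_bigr => j _.
  rewrite !mulr_sumr; apply: eq_bigr => k _.
  rewrite (eq_bigr (fun l => (u 0 i * v 0 j * v 0 k) *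
    (((al * kron R j k + be * x 0 k * x 0 j) * kron R i l +
     (- (al * kron R i k + be * x 0 k * x 0 i)) * kron R j l +
     be * (x 0 i * kron R j k - x 0 j * kron R i k) * x 0 l) * u 0 l))).
    by rewrite -mulr_sumr sum_kron_coord -dotpE -/xu; ring.
  by move=> l _; ring.
rewrite (eq_bigr (fun i => (al * dotp v v + be * xv ^+ 2) * (u 0 i * u 0 i) +
   (- (al * dotp u v + be * xu * xv)) * (u 0 i * v 0 i) +
   be * (xu * dotp v v - xv * dotp u v) * (x 0 i * u 0 i))).
  by rewrite sum_lin3 -!dotpE -/xu /gram /gram_along -/xu -/xv; ring.
move=> i _.
rewrite (eq_bigr (fun j => (al * u 0 i + be * xu * x 0 i) * (v 0 j * v 0 j) +
   (- (al * v 0 i + be * xv * x 0 i)) * (u 0 j * v 0 j) +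
   (be * (xv * u 0 i - xu * v 0 i)) * (x 0 j * v 0 j))).
  by rewrite sum_lin3 -!dotpE -/xv; ring.
by move=> j _; rewrite sum_kron_coord -dotpE -/xv; ring.
Qed.

(** The squared area of [u /\ v] for the chart metric, multiplied by [P / wght^4]. *)
Definition sec_denom x u v : R := P (sinsq x) * gram u v
  - wght x ^+ 2 * Q.[sinsq x] * gram_along x u v.

Lemma gram_along_le_sinsq x u v : 0 < gram u v ->
  wght x ^+ 2 * gram_along x u v <= sinsq x * gram u v.
Proof.
move=> G0; rewrite sinsqE -mulrA ler_wpM2l ?sqr_ge0//.
exact: gram_along_le.
Qed.

Lemma sec_denom_gt0 x u v : 0 < gram u v -> 0 < sec_denom x u v.
Proof.
move=> G0; rewrite (_ : sec_denom _ _ _ = gram u v + Q.[sinsq x] *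
  (sinsq x * gram u v - wght x ^+ 2 * gram_along x u v)).
  rewrite ltr_wpDr// mulr_ge0 ?geom_ge0 ?sinsq_ge0// subr_ge0.
  exact: gram_along_le_sinsq.
by rewrite /sec_denom /P /geomS -/Q; ring.
Qed.

(** For independent [u], [v], the ratio [gram_along / gram] is the squared length of the projection
    of [x] to their plane. The last quotient is therefore 0 for planes orthogonal to [x] and reaches
    its maximum [sinsq x] on planes containing [x]. *)
Lemma chart_sectional x u v : 0 < gram u v ->
  sectional (chart_metric r) x u v = sinsq x ^+ r.+1 +
  r.+1%:R * sinsq x ^+ r * (wght x ^+ 2 * gram_along x u v / sec_denom x u v).
Proof.
move=> G0; rewrite /sectional.
under eq_bigr => i _ do under eq_bigr => j _ do under eq_bigr => k _ do
  under eq_bigr => l _ do rewrite chart_riemann.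
rewrite sum_riemann_form !bilin_radial /chart_A /chart_B -/Q -/P.
have := sec_denom_gt0 x G0; have := @geomS_sinsq_neq0 R n r x; have := wght_neq0 x.
rewrite -/P /sec_denom.
set w := wght x; set p := P _; set q := Q.[_] => w0 p0 d0.
rewrite [X in _ / X](_ : _ = w ^+ 4 / p *
  (p * gram u v - w ^+ 2 * q * gram_along x u v)).
  by field; rewrite (gt_eqF d0) p0 w0.
by rewrite /gram /gram_along; field.
Qed.

Lemma chart_sectional_bounds x u v : 0 < gram u v ->
  sinsq x ^+ r.+1 <= sectional (chart_metric r) x u v
    <= r.+2%:R * sinsq x ^+ r.+1.
Proof.
move=> G0; rewrite chart_sectional//.
have s0 := sinsq_ge0 x; have Y0 := sec_denom_gt0 x G0.
apply/andP; split.
  rewrite lerDl; apply: mulr_ge0; first by rewrite mulr_ge0 ?ler0n ?exprn_ge0.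
  apply: divr_ge0; last exact: ltW.
  by rewrite mulr_ge0 ?sqr_ge0 ?gram_along_ge0.
rewrite (_ : r.+2%:R = 1 + r.+1%:R) ?mulrDl ?mul1r;
  last by rewrite -natr1 addrC.
rewrite lerD2l (exprSr (sinsq x)) [leRHS]mulrA.
rewrite ler_wpM2l ?mulr_ge0 ?ler0n ?exprn_ge0//.
rewrite ler_pdivrMr// /sec_denom -subr_ge0.
rewrite (_ : _ - _ = P (sinsq x) *
  (sinsq x * gram u v - wght x ^+ 2 * gram_along x u v)).
  by rewrite mulr_ge0 ?(ltW (geomS_gt0 _ s0))// subr_ge0 gram_along_le_sinsq.
by rewrite /P /geomS -/Q; ring.
Qed.

Lemma ortho_row_free u v : u != 0 -> v != 0 -> dotp u v = 0 ->
  row_free (col_mx u v).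
Proof.
move=> u0 v0 uv; apply: inj_row_free => z.
rewrite -[z]hsubmxK mul_row_col.
set a := lsubmx z; set b := rsubmx z.
rewrite [a]mx11_scalar [b]mx11_scalar !mul_scalar_mx => e.
have := congr1 (fun t => dotp t u) e; have := congr1 (fun t => dotp t v) e.
rewrite /= !dotp_bilE (dotpC v u) uv !mulr0 add0r addr0 !dotp0l.
move=> /eqP; rewrite mulf_eq0 (gt_eqF (dotp_gt0 v0)) orbF => /eqP b0.
move=> /eqP; rewrite mulf_eq0 (gt_eqF (dotp_gt0 u0)) orbF => /eqP a0.
by rewrite a0 b0 raddf0 row_mx0.
Qed.

(** The solutions form the left kernel of an [n] by 2 matrix, which is nonzero because its rank is
    at most 2. *)
Lemma exists_ortho2 x u : (3 <= n)%N ->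
  exists v, [/\ v != 0, dotp x v = 0 & dotp u v = 0].
Proof.
move=> n3; pose M := row_mx x^T u^T.
have /rowV0Pn[v vM v0] : kermx M != 0.
  rewrite -mxrank_eq0 -lt0n mxrank_ker subn_gt0.
  exact: leq_ltn_trans (rank_leq_col _) _.
exists v; split=> //; move: vM => /sub_kermxP; rewrite mul_mx_row -row_mx0.
  by move=> /eq_row_mx[e _]; rewrite dotpC /dotp e mxE.
by move=> /eq_row_mx[_ e]; rewrite dotpC /dotp e mxE.
Qed.

Lemma chart_sectional_min x : (3 <= n)%N -> exists u v,
  row_free (col_mx u v) /\
  sectional (chart_metric r) x u v = sinsq x ^+ r.+1.
Proof.
move=> n3; have [u [u0 xu _]] := exists_ortho2 x x n3.
have [v [v0 xv uv]] := exists_ortho2 x u n3.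
exists u, v; have uvf := ortho_row_free u0 v0 uv.
split=> //; rewrite chart_sectional ?gram_gt0// /gram_along xu xv.
by rewrite [X in _ + X](_ : _ = 0) ?addr0//; ring.
Qed.

Lemma chart_sectional_max x : (3 <= n)%N -> x != 0 -> exists u v,
  row_free (col_mx u v) /\
  sectional (chart_metric r) x u v = r.+2%:R * sinsq x ^+ r.+1.
Proof.
move=> n3 x0; have [v [v0 xv _]] := exists_ortho2 x x n3.
exists x, v; have xvf := ortho_row_free x0 v0 xv.
have G0 := gram_gt0 xvf.
split=> //; rewrite chart_sectional//.
have Z : wght x ^+ 2 * gram_along x x v = sinsq x * sec_denom x x v.
  rewrite sinsqE /sec_denom /P /geomS -/Q sinsqE /gram_along /gram xv; ring.
rewrite Z mulfK ?gt_eqF ?sec_denom_gt0// (exprSr (sinsq x)).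
by rewrite -[r.+2%:R]natr1; ring.
Qed.

End Sectional.

(** * The metric on the sphere *)

Section SphereMetric.
Variables (R : realType) (n r : nat).
Implicit Types (x : 'rV[R]_n) (p u v : 'rV[R]_(n + 1)).
Let Q : {poly R} := geom R r.
Let P : R -> R := @geomS R r.

Definition height u : R := u 0 (rshift n ord0).

(** On the sphere this is [1 - z^2], the variable [s] of the overview; as a squared norm it is
    nonnegative at every [p], which keeps [P] positive. *)
Definition latitude p : R := dotp (lsubmx p) (lsubmx p).

Definition sphere_metric : tensor2 R n := fun p u v =>
  dotp u v - Q.[latitude p] / P (latitude p) * height u * height v.

Lemma dotp_split u v :
  dotp u v = dotp (lsubmx u) (lsubmx v) + height u * height v.
Proof.
rewrite !dotpE big_split_ord /= big_ord1 /height; congr (_ + _).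
by apply: eq_bigr => i _; rewrite !mxE.
Qed.

Lemma height_row_mx x (a : R) : height (row_mx x a%:M) = a.
Proof. by rewrite /height row_mxEr mxE mulr1n. Qed.

Lemma latitude_ge0 p : 0 <= latitude p.
Proof. exact: dotp_ge0. Qed.

Lemma row_mx_height u : u = row_mx (lsubmx u) (height u)%:M.
Proof.
rewrite -[LHS]hsubmxK; congr row_mx; rewrite [LHS]mx11_scalar.
by rewrite /height mxE.
Qed.

Lemma sphere_metric_gt0 p u : sphere p -> tangent p u -> u != 0 ->
  0 < sphere_metric p u u.
Proof.
rewrite /sphere /tangent /= !dotp_split -/(latitude p) => Sp Tu u0.
have l0 := latitude_ge0 p; have P0 := geomS_gt0 r l0; rewrite -/P in P0.
(* Since [P - Q = 1 - (1 - s) Q = s^(q - 1)], multiplying by [P] leaves a sum of two nonnegative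
   terms. *)
have E : P (latitude p) * sphere_metric p u u =
    P (latitude p) * dotp (lsubmx u) (lsubmx u) +
    latitude p ^+ r.+1 * height u ^+ 2.
  have -> : latitude p ^+ r.+1 = 1 - (1 - latitude p) * Q.[latitude p].
    by rewrite geom_mul; ring.
  rewrite /sphere_metric dotp_split.
  move: (gt_eqF P0) => /negbT; rewrite /P /geomS -/Q => ?; field.
  by [].
rewrite -(pmulr_rgt0 _ P0) E.
have [lu|lu] := eqVneq (lsubmx u) 0; last first.
  rewrite ltr_wpDr//; last by rewrite mulr_gt0// dotp_gt0.
  by rewrite mulr_ge0 ?sqr_ge0 ?exprn_ge0.
(* A vertical tangent vector forces [p] onto the equator, where [latitude p = 1] and the second term
   is positive. *)
have hu : height u != 0.
  apply: contra u0 => /eqP hu; rewrite (row_mx_height u) lu hu.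
  by rewrite raddf0 row_mx0.
move: Tu; rewrite lu dotpC dotp0l add0r => /eqP.
rewrite mulf_eq0 (negPf hu) orbF => /eqP hp; move: Sp.
rewrite hp mulr0 addr0 => ->.
by rewrite dotp0l mulr0 add0r expr1n mul1r lt_def sqr_ge0 sqrf_eq0 hu.
Qed.

Lemma stereo_wght s x :
  stereo s x = row_mx (wght x *: x) ((-1) ^+ s * (1 - wght x))%:M.
Proof.
rewrite /stereo scale_row_mx scale_scalar_mx scalerA; congr row_mx.
  by rewrite /wght mulrC.
congr (_%:M); rewrite /wght; have := gt_eqF (dotp1_gt0 x) => /negbT ?.
by field.
Qed.

Lemma latitude_stereo s x : latitude (stereo s x) = sinsq x.
Proof.
by rewrite /latitude stereo_wght row_mxKl dotpZl dotpZr mulrA -expr2 sinsqE.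
Qed.

Definition stereo_frame s x (i : 'I_n) : 'rV[R]_(n + 1) :=
  row_mx (wght x *: delta_mx 0 i + (- (wght x ^+ 2 * x 0 i)) *: x)
         ((-1) ^+ s * (wght x ^+ 2 * x 0 i))%:M.

Lemma derive_stereo s x i :
  'D_(delta_mx 0 i) (stereo s) x = stereo_frame s x i.
Proof.
rewrite (_ : stereo s = fun y =>
    row_mx (wght y *: y) ((-1) ^+ s * (1 + -1 * wght y))%:M); last first.
  by apply/funext => y; rewrite stereo_wght mulN1r.
have dw := @radial_derive_wght R n x i.
have C c := is_derive_const (c : R) x (delta_mx 0 i).
apply: derive_row_mx => [j|].
  under eq_fun do rewrite mxE.
  apply: is_derive_eq (is_derive_mul dw (is_derive_coord_delta i j x)) _.
  by rewrite !mxE eqxx (eq_sym j) /= -/(kron R i j); ring.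
apply: is_derive_eq (is_derive_mul (C ((-1) ^+ s))
  (is_derive_add (C 1) (is_derive_mul (C (-1)) dw))) _.
by rewrite /=; ring.
Qed.

(** The sign [(-1) ^+ s] enters only squared, so both charts give the same matrix and one local
    computation serves them both. *)
Lemma in_chart_sphere_metric s : in_chart sphere_metric s = chart_metric r.
Proof.
apply/funext => x; apply/matrixP => i j.
rewrite !mxE /sphere_metric latitude_stereo !derive_stereo.
rewrite dotp_split !height_row_mx !row_mxKl.
rewrite !(dotpDl, dotpDr, dotpZl, dotpZr) (dotpC x (delta_mx _ _)).
rewrite !dotp_delta mxE eqxx /= -/(kron R i j).
rewrite /chart_A /chart_B -/Q -/P.
have e : dotp x x = (2 - wght x) / wght x.
  by rewrite -dotp_wght mulrAC divff ?mul1r// wght_neq0.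
rewrite e; have w0 := wght_neq0 x.
have p0 := @geomS_sinsq_neq0 R n r x; rewrite -/P in p0.
by case: s; rewrite ?expr1 ?expr0; field; rewrite p0 w0.
Qed.

Lemma Ck_horner (V : normedModType R) (U : set V) k (q : {poly R})
    (f : V -> R^o) :
  open U -> Ck_on U k f -> Ck_on U k (fun y => q.[f y] : R^o).
Proof.
move=> oU Cf.
rewrite (_ : (fun y => _) = (fun y => \sum_(i < size q) q`_i * f y ^+ i)).
  apply: Ck_sum => // i; apply: Ck_M => //; first exact: Ck_cst.
  exact: Ck_X.
by apply/funext => y; rewrite horner_coef.
Qed.

Lemma Ck_geomS (V : normedModType R) (U : set V) k (f : V -> R^o) :
  open U -> Ck_on U k f -> Ck_on U k (fun y => P (f y) : R^o).
Proof.
move=> oU Cf; apply: Ck_D => //; first exact: Ck_cst.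
by apply: Ck_M => //; exact: Ck_horner.
Qed.

Lemma Ck_chart_metric k i j :
  Ck_on setT k (fun x => chart_metric r x i j : R^o).
Proof.
have o : open [set: 'rV[R]_n] := openT.
have Cr : Ck_on setT k (fun x : 'rV[R]_n => dotp x x : R^o).
  rewrite (_ : (fun x => _) = (fun x => \sum_i x 0 i * x 0 i)); last first.
    by apply/funext => x; rewrite dotpE.
  by apply: Ck_sum => // m; apply: Ck_M => //; exact: Ck_coord.
have Cw : Ck_on setT k (fun x : 'rV[R]_n => wght x : R^o).
  apply: Ck_M => //; first exact: Ck_cst.
  apply: Ck_V => //; first by move=> x _; rewrite gt_eqF// dotp1_gt0.
  by apply: Ck_D => //; exact: Ck_cst.
have Cs : Ck_on setT k (fun x : 'rV[R]_n => sinsq x : R^o).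
  rewrite (_ : (fun x => _) = (fun x => wght x * (2 + -1 * wght x)));
    last first.
    by apply/funext => x; rewrite mulN1r.
  apply: Ck_M => //; apply: Ck_D => //; first exact: Ck_cst.
  by apply: Ck_M => //; exact: Ck_cst.
rewrite (_ : (fun x => _) = (fun x => wght x ^+ 2 * kron R i j +
    -1 * (wght x ^+ 4 * Q.[sinsq x] * (P (sinsq x))^-1) * x 0 i * x 0 j));
  last first.
  by apply/funext => x; rewrite mxE /chart_A /chart_B mulN1r.
have M := @Ck_M R _ _ o k; have C c := @Ck_cst R _ _ o k c.
apply: Ck_D => //.
  by apply: (M _ _); [exact: Ck_X|exact: (C _)].
apply: (M _ _); last exact: Ck_coord.
apply: (M _ _); last exact: Ck_coord.
apply: (M _ _); first exact: (C _).
apply: (M _ _); first by apply: (M _ _); [exact: Ck_X|exact: Ck_horner].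
apply: Ck_V => //; last exact: Ck_geomS.
by move=> x _; exact: geomS_sinsq_neq0.
Qed.

Lemma smooth_sphere_metric : smooth_metric sphere_metric.
Proof.
split.
- move=> p _ a u u' v _ _ _; rewrite /sphere_metric dotpDl dotpZl.
  by rewrite /height !mxE; ring.
- by move=> p _ u v _ _; rewrite /sphere_metric dotpC mulrAC.
- by move=> p Sp u Tu u0; exact: sphere_metric_gt0.
- by move=> s i j k; rewrite in_chart_sphere_metric; exact: Ck_chart_metric.
Qed.

(** Projection from one pole is centred at the other, hence the negation. *)
Lemma stereo0 s : stereo s 0 = pole R n (~~ s).
Proof.
rewrite stereo_wght scaler0 /pole; congr (row_mx _ _%:M).
rewrite /wght dotp0l add0r invr1 mulr1.
by case: s; rewrite /= ?expr0 ?expr1; ring.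
Qed.

Lemma stereo_pole s t x : stereo s x = pole R n t -> x = 0.
Proof.
rewrite stereo_wght => /eq_row_mx[/eqP + _].
by rewrite scaler_eq0 (negPf (wght_neq0 x)) => /eqP.
Qed.

Lemma sinsq_gt0 x : x != 0 -> 0 < sinsq x.
Proof.
by move=> x0; rewrite sinsqE mulr_gt0 ?exprn_gt0 ?wght_gt0 ?dotp_gt0.
Qed.

(** For [r = 0] the second coefficient of [chart_riemann] does not vanish at the origin; the
    products of coordinates next to it do. *)
Lemma riemann_chart0 i j k l :
  riemann (chart_metric r) i j k l (0 : 'rV[R]_n) = 0.
Proof.
rewrite chart_riemann sinsqE dotp0l mulr0 expr0n /= !mxE.
by rewrite !(mulr0, mul0r, addr0, subr0).
Qed.

Lemma flat_at_pole t : flat_at sphere_metric (pole R n t).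
Proof.
move=> s x /stereo_pole-> i j k l.
by rewrite in_chart_sphere_metric riemann_chart0.
Qed.

Lemma sec_curvatures_bounds p K : sec_curvatures sphere_metric p K ->
  latitude p ^+ r.+1 <= K <= r.+2%:R * latitude p ^+ r.+1.
Proof.
move=> [s [x [<- [u [v [/gram_gt0 G0 ->]]]]]].
by rewrite latitude_stereo in_chart_sphere_metric chart_sectional_bounds.
Qed.

Lemma sec_curvatures_gt0 p K : ~ is_pole p ->
  sec_curvatures sphere_metric p K -> 0 < K.
Proof.
move=> np HK; have /andP[+ _] := sec_curvatures_bounds HK.
apply: lt_le_trans; rewrite exprn_gt0//.
have [s [x [px _]]] := HK; rewrite -px latitude_stereo sinsq_gt0//.
by apply/eqP => x0; apply: np; exists (~~ s); rewrite -px x0 stereo0.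
Qed.

Lemma sphere_metric_pinched p : (3 <= n)%N -> ~ flat_at sphere_metric p ->
  pinched_exactly sphere_metric p (r.+2%:R^-1).
Proof.
move=> n3 nf.
(* If every chart sent [p] to the origin or missed it, [p] would be flat by [riemann_chart0]. *)
have [s [x [px x0]]] : exists s x, stereo s x = p /\ x != 0.
  apply: contrapT => h; apply: nf => s x px i j k l.
  have [->|x0] := eqVneq x 0.
    by rewrite in_chart_sphere_metric riemann_chart0.
  by case: h; exists s, x.
have l0 : 0 < latitude p ^+ r.+1.
  by rewrite exprn_gt0// -px latitude_stereo sinsq_gt0.
have K0 K : sec_curvatures sphere_metric p K -> 0 < K.
  by move=> /sec_curvatures_bounds/andP[+ _]; exact: lt_le_trans.
have [um [vm [fm Em]]] := chart_sectional_min r x n3.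
have [uM [vM [fM EM]]] := chart_sectional_max r n3 x0.
split=> //; first by left.
exists (latitude p ^+ r.+1), (r.+2%:R * latitude p ^+ r.+1); split.
- split; last first.
    move=> _ [K HK <-]; rewrite gtr0_norm ?K0//.
    by have /andP[] := sec_curvatures_bounds HK.
  exists (latitude p ^+ r.+1); last by rewrite gtr0_norm.
  exists s, x; split=> //; exists um, vm; split=> //.
  by rewrite in_chart_sphere_metric Em -px latitude_stereo.
- split; last first.
    move=> _ [K HK <-]; rewrite gtr0_norm ?K0//.
    by have /andP[] := sec_curvatures_bounds HK.
  exists (r.+2%:R * latitude p ^+ r.+1).
    exists s, x; split=> //; exists uM, vM; split=> //.
    by rewrite in_chart_sphere_metric EM -px latitude_stereo.
  by rewrite gtr0_norm// mulr_gt0// ltr0n.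
- by rewrite invfM mulrCA divff ?mulr1// gt_eqF.
Qed.

End SphereMetric.

(** * Inverting the primitive of a positive function *)

Section InversePrimitive.
Variable R : realType.

(** Solves [phi' = 1 / k (phi)] by separation of variables: [phi] inverts [T x], the integral of [k]
    from 0 to [x], and [L = T b]. *)
Lemma inverse_primitive (k : R -> R) (b : R) : 0 < b -> continuous k ->
  (forall x, 0 < k x) ->
  exists (L : R) (phi : R -> R), [/\ 0 < L, set_bij `]0, L[ `]0, b[ phi
    & forall t, t \in `]0, L[ -> is_derive t 1 phi (k (phi t))^-1].
Proof.
move=> b0 kc kpos.
(* The integral starts at -1 so that 0 is interior and [F] is derivable there too; subtracting [F 0]
   then restores the base point 0. *)
pose F (x : R) : R := (\int[@lebesgue_measure R]_(t in `[(-1)%R, x]) k t)%R.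
have DF (x : R) : -1 < x -> is_derive x 1 F (k x).
  move=> x1; have xu : x < x + 1 by rewrite ltrDl.
  have [|d e] := @continuous_FTC1_closed R k (-1) x (x + 1) xu _ x1 (kc x).
    apply: continuous_compact_integrable; first exact: segment_compact.
    exact: continuous_subspaceT.
  by split; [exact: d|rewrite -derive1E e].
pose T (x : R) : R := F x - F 0.
have DT (x : R) : -1 < x -> is_derive x 1 T (k x).
  move=> x1; rewrite -[k x]subr0.
  by apply: is_deriveB; exact: DF.
have itv1 (x : R) : 0 <= x -> -1 < x by move=> ?; lra.
have Tc (x : R) : -1 < x -> {for x, continuous T}.
  move=> /DT[d _]; exact/differentiable_continuous/derivable1_diffP.
have cT : {within `[0, b], continuous T}.
  apply: continuous_in_subspaceT => x; rewrite inE /= in_itv /= => /andP[x0 _].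
  exact/Tc/itv1.
have Tlt : {in `[0, b] &, {homo T : x y / x < y}}.
  apply: gtr0_derive1_lt_cc => // x; rewrite in_itv /= => /andP[x0 _].
    by have [] := DT x (itv1 _ (ltW x0)).
  by rewrite derive1E; have [_ ->] := DT x (itv1 _ (ltW x0)).
have Tinj : {in `[0, b] &, injective T}.
  move=> x y xb yb e; apply/eqP; case: ltgtP => // xy.
    by have := Tlt _ _ xb yb xy; rewrite e ltxx.
  by have := Tlt _ _ yb xb xy; rewrite e ltxx.
have T0 : T 0 = 0 by rewrite /T subrr.
have m0 : 0 \in `[0, b] by rewrite in_itv /= lexx ltW.
have mb : b \in `[0, b] by rewrite in_itv /= lexx ltW.
have L0 : 0 < T b by rewrite -T0 Tlt.
pose phi t := xget 0 [set x | (x \in `]0, b[) /\ T x = t].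
have phiT x : x \in `]0, b[ -> phi (T x) = x.
  move=> xb; rewrite /phi; case: xgetP => [y _ [yb /Tinj]|/(_ x)].
    by apply; exact: subset_itv_oo_cc.
  by case.
have phiP t : t \in `]0, T b[ -> (phi t \in `]0, b[) /\ T (phi t) = t.
  rewrite in_itv /= => /andP[t0 tb].
  have [|x xb Tx] := @IVT _ T 0 b t (ltW b0) cT.
    by rewrite T0 minEle maxEle (ltW L0) (ltW t0) (ltW tb).
  have xo : x \in `]0, b[.
    move: xb; rewrite !in_itv /= => /andP[x0 xb].
    rewrite !lt_neqAle x0 xb !andbT; apply/andP; split.
      by apply/eqP => e; move: t0; rewrite -Tx -e T0 ltxx.
    by apply/eqP => e; move: tb; rewrite -Tx e ltxx.
  by rewrite -Tx phiT.
exists (T b), phi; split=> //.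
  split.
  - by move=> t /= /phiP[].
  - move=> s t; rewrite !inE /= => /phiP[_ es] /phiP[_ et] e.
    by rewrite -es -et e.
  - move=> x /= xb; exists (T x); last exact: phiT.
    have xc : x \in `[0, b] by exact: subset_itv_oo_cc.
    move: (xb); rewrite /= !in_itv /= => /andP[x0 xb'].
    by rewrite -{1}T0 !Tlt.
move=> t /phiP[xb e]; rewrite -{1}e.
have x0 : 0 < phi t by move: xb; rewrite in_itv => /andP[].
apply: is_derive_inverse.
- apply: filterS (near_in_itvoo xb) => y; exact: phiT.
- apply: filterS (near_in_itvoo xb) => y; rewrite in_itv /= => /andP[y0 _].
  exact/Tc/itv1/ltW.
- exact/DT/itv1/ltW.
- by rewrite gt_eqF.
Qed.

End InversePrimitive.

(** * Arc length along the meridians *)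

Section RotationalSymmetry.
Variables (R : realType) (n r : nat).
Let Q : {poly R} := geom R r.
Let P : R -> R := @geomS R r.

Lemma sphere_metric_rotationally_symmetric :
  rotationally_symmetric (@sphere_metric R n r).
Proof.
pose S x := P (sin x ^+ 2) : R.
have S0 x : 0 < S x by rewrite geomS_gt0// sqr_ge0.
have CS k : Ck_on setT k (S : R^o -> R^o).
  apply: Ck_geomS; first exact: openT.
  by apply: Ck_X; [exact: openT|exact: (smooth_sin_cos R).1].
pose w x := Num.sqrt (S x).
have w0 x : 0 < w x by rewrite sqrtr_gt0.
have wn0 x : w x != 0 by rewrite gt_eqF.
have ogt : open ([set x | 0 < x] : set R^o) by exact: open_gt.
have Cw k : Ck_on setT k (w : R^o -> R^o).
  exact: (Ck_comp openT ogt (fun x _ => S0 x) (@smooth_sqrt R) (CS k)).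
have kc : continuous (fun x => (w x)^-1).
  move=> x; have := Ck_V (k := 0) openT (fun x _ => wn0 x) (Cw 0%N).
  by move=> /Ck_cont/(_ x I).
have kpos x : 0 < (w x)^-1 by rewrite invr_gt0.
(* Unit speed along meridians means [phi' = w (phi)] with [w^2 = P (sin^2 phi)], so the primitive to
   invert is that of [1 / w]. *)
have [L [phi [L0 bphi Dphi]]] := inverse_primitive (pi_gt0 R) kc kpos.
have {}Dphi t : t \in `]0, L[ -> is_derive t 1 phi (w (phi t)).
  by move=> /Dphi; rewrite invrK.
have oL : open ([set` `]0, L[] : set R^o) by exact: interval_open.
have cphi (t : R^o) : `]0, L[%classic t ->
    {for t, continuous (phi : R^o -> R^o)}.
  by move=> /Dphi[d _]; exact/differentiable_continuous/derivable1_diffP.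
(* Bootstrapping: the equation [phi' = w (phi)] with [w] smooth turns class [k] into class
   [k + 1]. *)
have Cphi k : Ck_on `]0, L[ k (phi : R^o -> R^o).
  elim: k => [|k IH]; first by split.
  apply: (CkS oL (dh := fun v t => v * w (phi t))) => //.
    by move=> v t /Dphi Dt; exact: is_derive_dir.
  move=> v; apply: Ck_M => //; first exact: Ck_cst.
  exact: (Ck_comp oL openT (fun _ _ => I) (fun j => Cw j) IH).
have phipi t : t \in `]0, L[ -> 0 < phi t < pi.
  by move=> tL; have [/(_ t tL)] := bphi; rewrite /= in_itv.
exists L, phi, (fun t => sin (phi t)); split=> //.
- split=> // t /Dphi Dt; rewrite derive1E.
  by have [_ ->] := Dt.
- move=> k; apply: (Ck_comp oL openT (fun _ _ => I) _ (Cphi k)).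
  exact: (smooth_sin_cos R).1.
- by move=> t /phipi; exact: sin_gt0_pi.
move=> t tL theta th1 a b v v' tv tv'.
have Dt := Dphi t tL.
have -> : derive1 (fun t' : R => polar phi t' theta) t =
    row_mx ((w (phi t) * cos (phi t)) *: theta) (w (phi t) * - sin (phi t))%:M.
  rewrite derive1E; apply: derive_row_mx.
    move=> j; under eq_fun do rewrite mxE; rewrite mxE.
    apply: is_derive_eq (is_derive_mul
      (is_derive_comp Dt (is_derive_sin (phi t)))
      (is_derive_const (theta 0 j) _ _)) _.
    by rewrite mulr0 addr0.
  exact: is_derive_comp Dt (is_derive_cos (phi t)).
have DE u : 'D_u (polar phi t) theta = row_mx (sin (phi t) *: u) 0%:M.
  apply: derive_row_mx.
  move=> j; under eq_fun do rewrite mxE; rewrite mxE.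
  apply: is_derive_eq (is_derive_mul (is_derive_const (sin (phi t)) _ _)
    (is_derive_coord j theta u)) _.
  by rewrite mul0r add0r.
have lat : latitude (polar phi t theta) = sin (phi t) ^+ 2.
  by rewrite /latitude row_mxKl dotpZl dotpZr th1 mulr1 -expr2.
have p0 : P (sin (phi t) ^+ 2) != 0 by rewrite gt_eqF// S0.
have w2 : w (phi t) ^+ 2 = P (sin (phi t) ^+ 2) by rewrite sqr_sqrtr// ltW// S0.
rewrite !DE /sphere_metric lat dotp_split !scale_row_mx !add_row_mx !row_mxKl.
rewrite !scale_scalar_mx -!raddfD /= !height_row_mx.
rewrite !(dotpDl, dotpDr, dotpZl, dotpZr) (dotpC v theta) th1 tv tv'.
rewrite -/Q -/P !(mulr0, addr0, add0r, mulr1).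
set c := cos _; set s := sin _; set W := w _; set p := P _; set q := Q.[_].
have c2 : c ^+ 2 = 1 - s ^+ 2 by rewrite -(cos2Dsin2 (phi t)) addrK.
(* The radial factor is [W^2 (1 - s^2 q / p)] with [W^2 = p] and [s^2 q = p - 1], hence equal to
   1. *)
transitivity (a * b * W ^+ 2 * (c ^+ 2 + s ^+ 2 - q / p * s ^+ 2)
  + s ^+ 2 * dotp v v'); first by ring.
congr (_ + _); rewrite c2 w2 -/s -/p.
have e : s ^+ 2 * q = p - 1 by rewrite /p /P /geomS -/Q -/q addrC addKr.
transitivity (a * b * (p - s ^+ 2 * q)); first by field.
by rewrite e; ring.
Qed.

End RotationalSymmetry.

Theorem proposition4p2 (R : realType) (n q : nat) (C : R)
    (hn : (3 <= n)%N) (hq : (2 <= q)%N) (hC : 0 < C) :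
  exists g : tensor2 R n,
    [/\ smooth_metric g,
        rotationally_symmetric g,
        forall p, sphere p -> ~ is_pole p ->
          forall K, sec_curvatures g p K -> 0 < K,
        forall s : bool, flat_at g (pole R n s)
      & forall p, sphere p -> ~ flat_at g p ->
          pinched_exactly g p (q%:R^-1)].
Proof.
case: q hq => [|[|r]] // _; exists (@sphere_metric R n r); split.
- exact: smooth_sphere_metric.
- exact: sphere_metric_rotationally_symmetric.
- by move=> p _ np K; exact: sec_curvatures_gt0.
- exact: flat_at_pole.
- by move=> p _; exact: sphere_metric_pinched.
Qed.
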